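(* Let $n\ge 1$ be an integer and let $h_2,h_4$ be the permutations of $\{1,\dots,2n\}$ associated with the Monge shuffles defined in the context. Then $h_2$ and $h_4$ have the same period, and this common period is the smallest integer $v\ge 1$ satisfying one of the two congruences $2^v\equiv 1\pmod{4n-1}$ or $2^v\equiv -1\pmod{4n-1}$.
   Context: The permutations $h_2,h_4$ of $\{1,\dots,2n\}$ are defined by: $h_2(i)=\frac{i}{2}+n$ if $i$ is even, $h_2(i)=n-\frac{i-1}{2}$ if $i$ is odd; $h_4(i)=\frac{i+1}{2}$ if $i$ is odd, $h_4(i)=2n+1-\frac{i}{2}$ if $i$ is even. The period of a permutation $\sigma$ of a finite set is the smallest integer $r\ge 1$ such that $\sigma^r=\mathrm{id}$ ($r$-fold composition). *)

(* Defs.v *)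
From mathcomp Require Import all_boot all_order all_fingroup all_algebra.
From mathcomp Require Import zify.
Set Implicit Arguments.
Unset Strict Implicit.
Unset Printing Implicit Defensive.

(* The set {1, ..., 2n}, as a finType. *)
Definition point (n : nat) : finType := {i : 'I_(2 * n).+1 | 0 < i}.

Definition point_nat (n : nat) (x : point n) : nat := val (val x).

Lemma point_natP (n : nat) (x : point n) : 1 <= point_nat x <= 2 * n.
Proof. by case: x => [[i Hi] /= Hp]; rewrite /point_nat /= Hp -ltnS. Qed.

Lemma point_nat_inj (n : nat) : injective (@point_nat n).
Proof. by move=> x y /val_inj/val_inj. Qed.

Definition mk_point (n i : nat) (Hi : 1 <= i <= 2 * n) : point n :=
  exist (fun j : 'I_(2 * n).+1 => 0 < j)
    (Ordinal (proj2 (andP Hi) : i < (2 * n).+1)) (proj1 (andP Hi)).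

(* For 1 <= i <= 2n, every division is exact and no subtraction truncates. *)
Definition h2_nat (n i : nat) : nat :=
  if odd i then n - (i - 1) %/ 2 else i %/ 2 + n.

Definition h4_nat (n i : nat) : nat :=
  if odd i then (i + 1) %/ 2 else 2 * n + 1 - i %/ 2.

Lemma h2_nat_bounds (n i : nat) : 1 <= i <= 2 * n -> 1 <= h2_nat n i <= 2 * n.
Proof. rewrite /h2_nat; case: ifP; lia. Qed.

Lemma h4_nat_bounds (n i : nat) : 1 <= i <= 2 * n -> 1 <= h4_nat n i <= 2 * n.
Proof. rewrite /h4_nat; case: ifP; lia. Qed.

Definition h2_fun (n : nat) (x : point n) : point n :=
  mk_point (h2_nat_bounds (point_natP x)).

Definition h4_fun (n : nat) (x : point n) : point n :=
  mk_point (h4_nat_bounds (point_natP x)).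

Lemma h2_fun_inj (n : nat) : injective (@h2_fun n).
Proof.
move=> x y /(congr1 (@point_nat n)) E; apply: point_nat_inj; move: E.
rewrite /point_nat /= -/(point_nat x) -/(point_nat y) /h2_nat.
by have := point_natP x; have := point_natP y; do 2! case: ifP; lia.
Qed.

Lemma h4_fun_inj (n : nat) : injective (@h4_fun n).
Proof.
move=> x y /(congr1 (@point_nat n)) E; apply: point_nat_inj; move: E.
rewrite /point_nat /= -/(point_nat x) -/(point_nat y) /h4_nat.
by have := point_natP x; have := point_natP y; do 2! case: ifP; lia.
Qed.

Definition h2 (n : nat) : {perm point n} := perm (@h2_fun_inj n).

Definition h4 (n : nat) : {perm point n} := perm (@h4_fun_inj n).

Lemma h2E (n : nat) (x : point n) : point_nat (h2 n x) = h2_nat n (point_nat x).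
Proof. by rewrite permE. Qed.

Lemma h4E (n : nat) (x : point n) : point_nat (h4 n x) = h4_nat n (point_nat x).
Proof. by rewrite permE. Qed.

Lemma period_ex (T : finType) (s : {perm T}) :
  exists r, (1 <= r) && (s ^+ r == 1)%g.
Proof. by exists #[s]%g; rewrite order_gt0 expg_order eqxx. Qed.

Definition period (T : finType) (s : {perm T}) : nat := ex_minn (period_ex s).

Definition is_least (P : nat -> Prop) (m : nat) : Prop :=
  P m /\ forall k, P k -> m <= k.

(* Main.v *)
Require Import Defs.
From mathcomp Require Import all_boot all_order all_fingroup all_algebra.
From mathcomp Require Import zify ring.

(* Put u = i - 1 for h4 and u = 2n - i for h2. In both cases u ranges over
   {0, ..., 2n-1}, a system of representatives of Z/(4n-1) modulo sign, and
   the shuffle sends u to u' with 2u' = u or 2u' = -u mod 4n-1. Hence the r-th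
   power is the identity iff multiplication by 2^r is trivial modulo sign,
   which is tested on u = 1. *)

Import GRing.Theory.
Local Open Scope ring_scope.

(** Equality in Z/N modulo sign; it merges the two congruences of the theorem into one relation,
    which can be chained and multiplied. *)
Definition eqpm (N a b : int) : Prop :=
  (a = b %[mod N])%Z \/ (a = - b %[mod N])%Z.

Lemma eqpmP (N a b : int) :
  eqpm N a b <-> exists e k : int, (e = 1 \/ e = -1) /\ a = e * b + k * N.
Proof.
split=> [[]/eqP | [e [k [[] -> ->]]]].
- by rewrite eqz_mod_dvd => /dvdzP[k E]; exists 1, k; split; [left | rewrite -E; ring].
- by rewrite eqz_mod_dvd => /dvdzP[k E]; exists (-1), k; split; [right | rewrite -E; ring].
- by left; rewrite addrC modzMDl mul1r.
- by right; rewrite addrC modzMDl mulN1r.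
Qed.

Lemma eqpm_sym (N a b : int) : eqpm N a b -> eqpm N b a.
Proof.
move=> /eqpmP[e [k [[] -> ->]]]; apply/eqpmP.
- by exists 1, (- k); split; [left | ring].
- by exists (-1), k; split; [right | ring].
Qed.

Lemma eqpm_trans (N a b c : int) : eqpm N a b -> eqpm N b c -> eqpm N a c.
Proof.
move=> /eqpmP[e [k [He ->]]] /eqpmP[f [l [Hf ->]]]; apply/eqpmP.
exists (e * f), (e * l + k); split; last ring.
by case: He Hf => -> [] ->; rewrite ?mul1r ?mulN1r ?opprK; [left | right | right | left].
Qed.

Lemma eqpm_mul2l (N c a b : int) : eqpm N a b -> eqpm N (c * a) (c * b).
Proof.
by move=> /eqpmP[e [k [He ->]]]; apply/eqpmP; exists e, (c * k); split; [|ring].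
Qed.

(** Both [a - b] and [a + b] have absolute value below [N], so whichever is a multiple of [N]
    vanishes; [a + b = 0] forces both to be 0. *)
Lemma eqpm_small_inj (N : int) (a b : nat) :
  a%:Z + a%:Z < N -> b%:Z + b%:Z < N -> eqpm N a b -> a = b.
Proof.
move=> Ha Hb [] /eqP; rewrite eqz_mod_dvd => /dvdzP[k E].
all: have [k0 | k0] : k = 0 \/ k <> 0 by lia.
all: by [move: E; rewrite k0; lia | nia].
Qed.

Section Halving.

Variables (T : finType) (s : {perm T}) (N : int) (u : T -> nat).
Hypothesis u_inj : injective u.
Hypothesis u_small : forall x, (u x)%:Z + (u x)%:Z < N.
Hypothesis u_one : exists x, u x = 1%N.
Hypothesis u_half : forall x, eqpm N (2 * (u (s x))%:Z) (u x).

(** Induction on [r]: the last application of [s] absorbs one factor 2. The sign may vary with [x]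
    and [r], which [eqpm] hides. *)
Lemma eqpm_expn_halving (r : nat) (x : T) :
  eqpm N (2 ^+ r * (u ((s ^+ r)%g x))%:Z) (u x).
Proof.
elim: r => [|r IH]; first by rewrite expg0 perm1 mul1r; left.
rewrite expgSr permM exprSr -mulrA.
exact: eqpm_trans (eqpm_mul2l _ _ _ _ (u_half _)) IH.
Qed.

Lemma expg_halving_eq1 (r : nat) : (s ^+ r = 1)%g <-> eqpm N (2 ^+ r) 1.
Proof.
split=> [sr1 | r1].
  have [x ux1] := u_one; have := eqpm_expn_halving r x.
  by rewrite sr1 perm1 ux1 mulr1.
apply/permP=> x; rewrite perm1; apply/u_inj/(eqpm_small_inj N) => //.
(* It remains to multiply [2 ^+ r], which is 1 up to sign, by the coordinate of the image of [x]. *)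
apply: eqpm_trans (eqpm_expn_halving r x); apply: eqpm_sym.
by rewrite -[X in eqpm _ _ X]mulr1 mulrC; apply: eqpm_mul2l.
Qed.

Lemma period_halving :
  is_least (fun v => (1 <= v)%N /\ eqpm N (2 ^+ v) 1) (period s).
Proof.
rewrite /period; case: ex_minnP => m /andP[m_gt0 /eqP sm1] m_min.
split=> [|k [k_gt0 /expg_halving_eq1 sk1]].
  by split=> //; apply/expg_halving_eq1.
by apply: m_min; rewrite k_gt0 sk1 eqxx.
Qed.

End Halving.

Lemma is_least_uniq (P : nat -> Prop) (m k : nat) :
  is_least P m -> is_least P k -> m = k.
Proof. by move=> [Pm m_min] [Pk k_min]; apply/eqP; rewrite eqn_leq m_min ?k_min. Qed.

Lemma period_h2 (n : nat) : (1 <= n)%N ->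
  is_least (fun v => (1 <= v)%N /\ eqpm (4%:Z * n%:Z - 1) (2 ^+ v) 1)
    (period (h2 n)).
Proof.
move=> n_gt0; apply: (period_halving _ _ _ (fun x : point n => 2 * n - point_nat x)%N).
- move=> x y E; apply: point_nat_inj.
  by have := point_natP x; have := point_natP y; lia.
- by move=> x; have := point_natP x; lia.
(* The coordinate [2n - i] equals 1 at [i = 2n - 1]. *)
- have H : (1 <= 2 * n - 1 <= 2 * n)%N by lia.
  by exists (mk_point H); rewrite /point_nat /=; lia.
- move=> x; rewrite h2E /h2_nat; have := point_natP x.
  (* For odd [i], [2u' = 2n + i - 1 = -(2n - i) + (4n - 1)]; for even [i], [2u' = 2n - i]
     exactly. *)
  case: ifP => x_odd Hx; apply/eqpmP.
  + by exists (-1), 1; split; [right | lia].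
  + by exists 1, 0; split; [left | lia].
Qed.

Lemma period_h4 (n : nat) : (1 <= n)%N ->
  is_least (fun v => (1 <= v)%N /\ eqpm (4%:Z * n%:Z - 1) (2 ^+ v) 1)
    (period (h4 n)).
Proof.
move=> n_gt0; apply: (period_halving _ _ _ (fun x : point n => point_nat x - 1)%N).
- move=> x y E; apply: point_nat_inj.
  by have := point_natP x; have := point_natP y; lia.
- by move=> x; have := point_natP x; lia.
(* The coordinate [i - 1] equals 1 at [i = 2]. *)
- have H : (1 <= 2 <= 2 * n)%N by lia.
  by exists (mk_point H).
- move=> x; rewrite h4E /h4_nat; have := point_natP x.
  (* For odd [i], [2u' = i - 1] exactly; for even [i], [2u' = 4n - i = -(i - 1) + (4n - 1)]. *)
  case: ifP => x_odd Hx; apply/eqpmP.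
  + by exists 1, 0; split; [left | lia].
  + by exists (-1), 1; split; [right | lia].
Qed.

Local Close Scope ring_scope.

Theorem mainTheorem7 (n : nat) (hn : 1 <= n) :
  period (h2 n) = period (h4 n) /\
  is_least
    (fun v : nat => 1 <= v /\
       ((2%:Z ^+ v = 1 %[mod 4%:Z * n%:Z - 1])%Z \/
        (2%:Z ^+ v = -1 %[mod 4%:Z * n%:Z - 1])%Z))
    (period (h2 n)).
Proof.
split; last exact: period_h2.
(* Both periods are the least element of the same set of exponents. *)
exact: is_least_uniq (period_h2 n hn) (period_h4 n hn).
Qed.
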